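(* Let $D$ be a Krull domain admitting a prime element $\pi$ such that $D/\pi D$ is finite. Let $K$ be the quotient field of $D$ and $\operatorname{Int}(D)=\{f\in K[X]\mid f(D)\subseteq D\}$. Then $\operatorname{Int}(D)$ has full system of multisets of lengths, i.e., for all positive integers $k$ and all integers $1<n_1\leq\ldots\leq n_k$ there exists an integer-valued polynomial $H\in\operatorname{Int}(D)$ which has precisely $k$ essentially different factorizations into irreducible elements of $\operatorname{Int}(D)$, and the lengths of these $k$ factorizations are exactly $n_1,\ldots,n_k$ (counted with multiplicity).
   Context: For an integral domain $R$, a non-zero non-unit is irreducible if it cannot be written as a product of two non-units of $R$. A factorization of $r\in R$ is a decomposition $r=a_1\cdots a_n$ into irreducible elements $a_i$ of $R$; $n$ is its length. Two elements $r,s\in R$ are associated if $r=\varepsilon s$ for some unit $\varepsilon\in R$. Two factorizations $r=a_1\cdots a_n=u_1\cdots u_m$ are essentially the same if $n=m$ and, after re-indexing if necessary, $u_i$ is associated to $a_i$ for all $i$; otherwise they are essentially different. *)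

(* Defs.v *)
From HB Require Import structures.
From mathcomp Require Import all_boot all_order all_algebra.
From mathcomp Require Import ring_quotient.
From mathcomp Require Import boolp classical_sets functions cardinality.

Set Implicit Arguments.
Unset Strict Implicit.
Unset Printing Implicit Defensive.
Import Order.TTheory GRing.Theory Num.Theory.
Local Open Scope ring_scope.

Notation "x %:F" := (tofrac x) : ring_scope.

Section Factorizations.
Variable R : idomainType.
Implicit Types (r s a : R) (u t : seq R).

Definition irreducible_elt a : Prop :=
  [/\ a != 0, a \isn't a GRing.unit &
      forall b c, a = b * c -> b \is a GRing.unit \/ c \is a GRing.unit].

Definition associated r s : Prop :=
  exists2 e : R, e \is a GRing.unit & r = e * s.

(* The length of the factorization [u] is [size u]. The empty sequence is
   allowed; it is a factorization of 1 only. *)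
Definition factorization r u : Prop :=
  r = \prod_(a <- u) a /\ (forall a, a \in u -> irreducible_elt a).

Definition essentially_same u t : Prop :=
  size u = size t /\
  exists2 t' : seq R, perm_eq t' t &
    forall i, (i < size u)%N -> associated t'`_i u`_i.

Definition full_system_of_multisets_of_lengths : Prop :=
  forall (k : nat) (n : 'I_k -> nat),
    (0 < k)%N -> (forall i, (1 < n i)%N) ->
    (forall i j : 'I_k, (i <= j)%N -> (n i <= n j)%N) ->
  exists (H : R) (fac : 'I_k -> seq R),
    [/\ forall i, factorization H (fac i),
        forall i, size (fac i) = n i,
        forall i j, i != j -> ~ essentially_same (fac i) (fac j) &
        forall u, factorization H u -> exists i, essentially_same u (fac i)].

End Factorizations.

Definition prime_elt (D : idomainType) (p : D) : Prop :=
  [/\ p != 0, p \isn't a GRing.unit &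
      forall a b c : D, a * b = p * c ->
        (exists d, a = p * d) \/ (exists d, b = p * d)].

Definition cosets (D : idomainType) (p : D) : set (set D) :=
  range (fun x : D => [set x + p * d | d in [set: D]]%classic).

Section Krull.
Variable D : idomainType.
Local Notation K := {fraction D}.
Implicit Types P Q : {pred D}.

Definition prime_ideal P : Prop := idealr_closed P /\ prime_idealr_closed P.

(* Since (0) is a prime ideal of the domain D, a prime has height one iff it is
   nonzero and no nonzero prime lies strictly below it. *)
Definition height_one_prime P : Prop :=
  [/\ prime_ideal P, exists2 a, a \in P & a != 0 &
      forall Q, prime_ideal Q -> (exists2 a, a \in Q & a != 0) ->
        {subset Q <= P} -> Q =i P].

Definition localization P : set K :=
  [set x | exists a s : D, s \notin P /\ x = a%:F / s%:F]%classic.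

(* Only the values of [v] on nonzero elements matter; [v 0] is junk. *)
Definition discrete_valuation (F : fieldType) (v : F -> int) : Prop :=
  [/\ forall m : int, exists2 x, x != 0 & v x = m,
      forall x y, x != 0 -> y != 0 -> v (x * y) = v x + v y &
      forall x y, x != 0 -> y != 0 -> x + y != 0 ->
        Num.min (v x) (v y) <= v (x + y)].

Definition discrete_valuation_ring (F : fieldType) (V : set F) : Prop :=
  exists2 v : F -> int, discrete_valuation v &
    V = [set x | x = 0 \/ (x != 0 /\ 0 <= v x)]%classic.

Definition krull_domain : Prop :=
  [/\ forall P, height_one_prime P -> discrete_valuation_ring (localization P),
      forall x : K, (forall P, height_one_prime P -> localization P x) ->
        exists a : D, x = a%:F &
      forall a : D, a != 0 ->
        finite_set [set P : {pred D} | height_one_prime P /\ a \in P]%classic].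

Definition int_valued : {pred {poly K}} :=
  [pred f : {poly K} | `[< forall d : D, exists c : D, f.[d%:F] = c%:F >]].

Lemma int_valuedP (f : {poly K}) :
  reflect (forall d : D, exists c : D, f.[d%:F] = c%:F) (f \in int_valued).
Proof. exact: asboolP. Qed.

Lemma int_valued_subring : subring_closed int_valued.
Proof.
split.
- by apply/int_valuedP => d; exists 1; rewrite hornerC rmorph1.
- move=> f g /int_valuedP hf /int_valuedP hg; apply/int_valuedP => d.
  have [a ea] := hf d; have [b eb] := hg d.
  by exists (a - b); rewrite !hornerE ea eb rmorphB.
- move=> f g /int_valuedP hf /int_valuedP hg; apply/int_valuedP => d.
  have [a ea] := hf d; have [b eb] := hg d.
  by exists (a * b); rewrite hornerM ea eb rmorphM.
Qed.

End Krull.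

Arguments int_valued : clear implicits.
Arguments krull_domain : clear implicits.

(* Int(D), an integral domain under the operations of K[X]. Its units are its
   own invertible elements, not those of K[X]. *)
Record Int (D : idomainType) := MkInt {
  int_poly :> {poly {fraction D}};
  int_polyP : int_poly \in int_valued D
}.

HB.instance Definition _ (D : idomainType) := [isSub for @int_poly D].
HB.instance Definition _ (D : idomainType) := [Choice of Int D by <:].
HB.instance Definition _ (D : idomainType) :=
  GRing.SubChoice_isSubComNzRing.Build _ (int_valued D) (Int D)
    (@int_valued_subring D).

Section IntDomain.
Variable D : idomainType.

Definition Int_unit : {pred Int D} :=
  [pred f : Int D | `[< exists g : Int D, g * f = 1 >]].

Definition Int_inv (f : Int D) : Int D :=
  if pselect (exists g : Int D, g * f = 1) is left e
  then projT1 (cid e) else f.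

Lemma Int_mulVx : {in Int_unit, left_inverse 1 Int_inv *%R}.
Proof.
move=> f /asboolP e; rewrite /Int_inv.
by case: pselect => // e'; case: (cid e').
Qed.

Lemma Int_unitPl (f g : Int D) : g * f = 1 -> Int_unit f.
Proof. by move=> e; apply/asboolP; exists g. Qed.

Lemma Int_invr_out : {in [predC Int_unit], Int_inv =1 id}.
Proof.
move=> f /negP e; rewrite /Int_inv; case: pselect => // e'.
by case: e; apply/asboolP.
Qed.

HB.instance Definition _ := GRing.ComNzRing_hasMulInverse.Build (Int D)
  Int_mulVx Int_unitPl Int_invr_out.

Lemma Int_mulf_eq0 : GRing.integral_domain_axiom (Int D).
Proof.
move=> f g /(congr1 val); rewrite rmorphM rmorph0 => /eqP.
by rewrite mulf_eq0 -!(inj_eq val_inj) !rmorph0.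
Qed.

HB.instance Definition _ :=
  GRing.ComUnitRing_isIntegral.Build (Int D) Int_mulf_eq0.

End IntDomain.

(* Main.v *)
(* Let K be the quotient field of D, v the p-adic valuation of K, and C the
   finite set of residue classes modulo p.  For c in C and b > 0 there is an
   F in D[X], irreducible in K[X], such that v(F(a)) = b if a lies in the class
   c and v(F(a)) = 0 otherwise; moreover F(0) is a unit of D times a power of
   p.  Let H be a product of finitely many pairwise non-associated such F, of
   total weight m in every class, divided by p^m.  In a factorization of H in
   Int(D) every factor takes values prime to p, so it is, up to a constant,
   the product over a set A of these F whose total weight in the class c does
   not depend on c ("tight" sets); evaluating at 0 shows that the constant is a
   power of p times a unit of D, so that no other prime of D interferes.
   Index the F by the points of the grid [n_1] x ... x [n_k], with one F per
   class at each point.  Subsets of the grid whose indicator is a sum of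
   functions of one coordinate each are unions of parallel slices, and
   this is a system of linear equations on the indicator.  Suitable weights
   encode all these equations in the single condition of tightness, so the
   factorizations of H are the k partitions of the grid into the n_h slices
   orthogonal to the h-th axis. *)

Require Import Defs.
From mathcomp Require Import boolp classical_sets functions cardinality.
From mathcomp Require Import all_boot all_order all_algebra zify.

Set Implicit Arguments.
Unset Strict Implicit.
Unset Printing Implicit Defensive.
Import Order.TTheory GRing.Theory Num.Theory.
Local Open Scope ring_scope.

(** * Discrete valuations and Newton polygons *)

Section DiscreteValuation.
Variables (F : fieldType) (v : F -> int).
Hypothesis hv : discrete_valuation v.
Implicit Types (x y : F) (m : int).

Lemma valM x y : x != 0 -> y != 0 -> v (x * y) = v x + v y.
Proof. by case: hv => _ + _; apply. Qed.

Lemma val1 : v 1 = 0.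
Proof.
by apply: (addrI (v 1)); rewrite -valM ?oner_neq0 // mulr1 addr0.
Qed.

Lemma valX x n : x != 0 -> v (x ^+ n) = v x *+ n.
Proof.
move=> x0; elim: n => [|n IHn]; first by rewrite expr0 val1.
by rewrite exprS valM ?expf_neq0 // IHn mulrS.
Qed.

Lemma valV x : x != 0 -> v x^-1 = - v x.
Proof.
move=> x0; apply: (addrI (v x)).
by rewrite -valM ?invr_neq0 // mulfV // val1 subrr.
Qed.

Lemma valN x : x != 0 -> v (- x) = v x.
Proof.
have N1 : (-1 : F) != 0 by rewrite oppr_eq0 oner_neq0.
have vN1 : v (-1) = 0.
  by have := valM N1 N1; rewrite mulrNN mulr1 val1; move: (v _) => *; lia.
by move=> x0; rewrite -mulN1r valM // vN1 add0r.
Qed.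

(** Admits 0 for every bound, since [v 0] is junk and stands for infinite valuation. *)
Definition val_ge m x : bool := (x == 0) || (m <= v x).

Lemma val_geD m x y : val_ge m x -> val_ge m y -> val_ge m (x + y).
Proof.
rewrite /val_ge.
have [->|x0] := eqVneq x 0; first by rewrite add0r.
have [->|y0] := eqVneq y 0; first by rewrite addr0 (negPf x0).
have [//|xy0] /= := eqVneq (x + y) 0.
case: hv => _ _ /(_ _ _ x0 y0 xy0) le_xy hx hy.
by apply: le_trans le_xy; rewrite le_min hx hy.
Qed.

Lemma val_geN m x : val_ge m (- x) = val_ge m x.
Proof. by rewrite /val_ge oppr_eq0; case: eqP => //= /eqP x0; rewrite valN. Qed.

Lemma val_ge_sum m (I : Type) (r : seq I) (P : pred I) (G : I -> F) :
  (forall i, P i -> val_ge m (G i)) -> val_ge m (\sum_(i <- r | P i) G i).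
Proof.
by move=> h; elim/big_ind: _ => //; [rewrite /val_ge eqxx | move=> *; exact: val_geD].
Qed.

(** If [x + y] vanished or had larger valuation than [x], then so would [x], being the difference of
    [x + y] and [y]. *)
Lemma val_dominant x y : x != 0 -> val_ge (v x + 1) y ->
  x + y != 0 /\ v (x + y) = v x.
Proof.
move=> x0 gey.
have xy0 : x + y != 0.
  apply: contraTneq gey => /eqP; rewrite addrC addr_eq0 => /eqP->.
  by rewrite val_geN /val_ge (negPf x0) /=; move: (v x) => *; lia.
split=> //.
have lo : val_ge (v x) (x + y).
  by apply: val_geD; rewrite /val_ge ?lexx ?orbT //; move: gey; rewrite /val_ge; lia.
have [//|ne] := eqVneq (v (x + y)) (v x).
have : val_ge (v x + 1) (x + y - y).
  apply: val_geD; last by rewrite val_geN.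
  by move: lo ne; rewrite /val_ge (negPf xy0) /=; move: (v _) (v _) => *; lia.
by rewrite addrK /val_ge (negPf x0) /=; move: (v x) => *; lia.
Qed.

Section Newton.
Variables (n b : nat).

(* The weight of the i-th term, for the monomial valuation giving the variable
   the value b / n, scaled by n. *)
Definition weight (g : {poly F}) i : int := v g`_i *+ n + (b * i)%:Z.

(** The leftmost minimum is chosen: strictness to its left makes a single term dominate in a
    coefficient of a product. *)
Lemma min_weight (g : {poly F}) : g != 0 ->
  exists i, [/\ g`_i != 0, forall j, g`_j != 0 -> weight g i <= weight g j &
    forall j, (j < i)%N -> g`_j != 0 -> weight g i < weight g j].
Proof.
move=> g0; have lg : ((size g).-1 < size g)%N by rewrite prednK // size_poly_gt0.
pose P := [pred i : 'I_(size g) | g`_i != 0].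
have Pl : P (Ordinal lg) by rewrite /= -lead_coefE lead_coef_eq0.
have [i Pi mini] := arg_minP (fun i : 'I_(size g) => weight g i) Pl.
have lt j : g`_j != 0 -> (j < size g)%N.
  by apply: contraNltn => ?; rewrite nth_default.
have [|i0 /andP[gi0 /eqP wi0] min0] :=
  @ex_minnP (fun j => (g`_j != 0) && (weight g j == weight g i)).
  by exists i; rewrite eqxx andbT.
exists i0; rewrite wi0; split => // [j gj|j ji gj].
  exact: (mini (Ordinal (lt _ gj))).
rewrite lt_neqAle (mini (Ordinal (lt _ gj))) // andbT.
by apply: contraTneq ji => wj; rewrite -leqNgt min0 // gj wj eqxx.
Qed.

(** Gauss's lemma for the monomial valuation. Any other nonzero term of the coefficient at [i + j]
    has one index strictly left of its leftmost minimum, hence strictly larger weight, so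
    [val_dominant] applies. *)
Lemma weightM_coef (g h : {poly F}) i j : (0 < n)%N ->
  g`_i != 0 -> h`_j != 0 ->
  (forall k, g`_k != 0 -> weight g i <= weight g k) ->
  (forall k, (k < i)%N -> g`_k != 0 -> weight g i < weight g k) ->
  (forall k, h`_k != 0 -> weight h j <= weight h k) ->
  (forall k, (k < j)%N -> h`_k != 0 -> weight h j < weight h k) ->
  (g * h)`_(i + j) != 0 /\ weight (g * h) (i + j) = weight g i + weight h j.
Proof.
move=> n0 gi hj ming ltg minh lth.
have lij : (i < (i + j).+1)%N by lia.
have [||nz e] := @val_dominant (g`_i * h`_j)
  (\sum_(k < (i + j).+1 | k != Ordinal lij) g`_k * h`_(i + j - k)).
- by rewrite mulf_neq0.
- apply: val_ge_sum => k ki; rewrite /val_ge mulf_eq0.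
  case: eqVneq => //= gk; case: eqVneq => //= hk.
  rewrite !valM //.
  have : (weight g i + weight h j < weight g k + weight h (i + j - k))%R.
    have [lt_ki|le_ik] := ltnP k i.
      have := minh _ hk; have := ltg _ lt_ki gk; lia.
    have lt_j : (i + j - k < j)%N.
      have : nat_of_ord k != i by apply: contraNneq ki => e; apply/eqP/val_inj.
      by move: (ltn_ord k); lia.
    have := ming _ gk; have := lth _ lt_j hk; lia.
  rewrite /weight; move: (v _) (v _) (v _) (v _) => x y z t.
  have := ltn_ord k; nia.
have Ecoef : (g * h)`_(i + j) =
    g`_i * h`_j + \sum_(k < (i + j).+1 | k != Ordinal lij) g`_k * h`_(i + j - k).
  by rewrite coefM (bigD1 (Ordinal lij)) //= addKn.
by rewrite /weight Ecoef e valM //; split => //; lia.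
Qed.

(* Eisenstein--Dumas: the Newton polygon is the single segment from (0, b) to
   (n, 0), which contains no lattice point besides its endpoints. *)
Lemma newton_irreducible (f : {poly F}) : coprime n b -> (0 < n)%N ->
    size f = n.+1 -> v (lead_coef f) = 0 -> f`_0 != 0 -> v f`_0 = b ->
    (forall i, f`_i != 0 -> (n * b)%:Z <= weight f i) ->
  irreducible_poly f.
Proof.
move=> co n0 sf vl f0 v0 above; split; first by rewrite sf.
move=> g sg /dvdpP[h Ef].
have f_neq0 : f != 0 by rewrite -size_poly_eq0 sf.
have [h0 g0] : h != 0 /\ g != 0.
  by apply/andP; rewrite -negb_or -mulf_eq0 -Ef.
have [i [gi ming ltg]] := min_weight g0.
have [j [hj minh lth]] := min_weight h0.
have [nz wij] := weightM_coef n0 hj gi minh lth ming ltg.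
have E0 : f`_0 = h`_0 * g`_0 by rewrite Ef coefM big_ord1.
have [h00 g00] : h`_0 != 0 /\ g`_0 != 0.
  by apply/andP; rewrite -negb_or -mulf_eq0 -E0.
have := above (j + i)%N; rewrite Ef => /(_ nz); rewrite wij => le_min.
have s_hg : (n.+1 = (size h + size g).-1)%N by rewrite -sf Ef size_mul.
have sh0 : (0 < size h)%N by rewrite size_poly_gt0.
have sg0 : (0 < size g)%N by rewrite size_poly_gt0.
have lg : g`_(size g).-1 != 0 by rewrite -lead_coefE lead_coef_eq0.
have lh : h`_(size h).-1 != 0 by rewrite -lead_coefE lead_coef_eq0.
have W0 : weight h 0 + weight g 0 = (n * b)%:Z.
  by rewrite /weight muln0 !addr0 -mulrnDl -valM // -E0 v0 -mulr_natr natz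
    -PoszM mulnC.
have W1 : weight h (size h).-1 + weight g (size g).-1 = (n * b)%:Z.
  rewrite /weight addrACA -mulrnDl -valM // -!lead_coefE -lead_coefM -Ef vl.
  rewrite mul0rn add0r -PoszD -mulnDr mulnC; congr (_ * _)%N%:Z.
  by clear -s_hg sh0 sg0; lia.
(* The weights of [g] and [h] add up to n b both at index 0 and at the top, while their minima add
   up to at least n b. So [g] attains its minimum at both ends. *)
have eq_w : weight g 0 = weight g (size g).-1.
  move: (ming _ g00) (minh _ h00) (ming _ lg) (minh _ lh) W0 W1 le_min.
  move: (weight g 0) (weight h 0) (weight g i) (weight h j).
  by move: (weight g (size g).-1) (weight h (size h).-1) (n * b)%:Z; clear => *; lia.
have dn : (n %| (size g).-1)%N.
  rewrite -(Gauss_dvdr _ co).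
  rewrite -[(_ %| _)%N]/((n %| (b * (size g).-1)%N%:Z)%Z).
  apply/dvdzP; exists (v g`_0 - v g`_(size g).-1).
  have scale (x : F) : v x * n%:Z = v x *+ n by rewrite -mulr_natr natz.
  move: eq_w; rewrite /weight muln0 addr0 mulrBl !scale => ->.
  by rewrite addrAC subrr add0r.
rewrite -dvdp_size_eqp ?Ef ?dvdp_mulIr // -Ef sf.
(* The degree of [g] is a positive multiple of [n] and at most [n], so [h] is constant. *)
have sh1 : (size h <= 1)%N.
  case/dvdnP: dn => q E; have q0 : (0 < q)%N.
    by case: q E => // E; case/eqP: sg; clear -E sg0; lia.
  by clear -E q0 s_hg sh0 sg0 n0; nia.
by apply/eqP; clear -sh1 sh0 s_hg; lia.
Qed.

End Newton.
End DiscreteValuation.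

(** * The p-adic valuation and the residue classes *)

Definition divides (D : idomainType) (p a : D) : Prop := exists d, a = p * d.

Section PrimeElement.
Variables (D : idomainType) (p : D).
Hypothesis hp : prime_elt p.
Implicit Types (a b d : D).

Lemma divides0 : divides p 0.
Proof. by exists 0; rewrite mulr0. Qed.

Lemma divides1 : ~ divides p 1.
Proof. by case: hp => _ /negP nu _ [d e]; case: nu; apply/unitrPr; exists d. Qed.

Lemma dividesD a b : divides p a -> divides p b -> divides p (a + b).
Proof. by case=> d -> [e ->]; exists (d + e); rewrite mulrDr. Qed.

Lemma dividesN a : divides p a -> divides p (- a).
Proof. by case=> d ->; exists (- d); rewrite mulrN. Qed.

Lemma divides_mull a b : divides p b -> divides p (a * b).
Proof. by case=> d ->; exists (a * d); rewrite mulrCA. Qed.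

Lemma divides_mulr a b : divides p a -> divides p (a * b).
Proof. by rewrite mulrC; exact: divides_mull. Qed.

Lemma dividesM a b : divides p (a * b) -> divides p a \/ divides p b.
Proof. by case: hp => _ _ pr [d /pr]. Qed.

Lemma dividesX a n : divides p (a ^+ n) -> divides p a.
Proof.
elim: n => [|n IHn]; first by rewrite expr0 => /divides1.
by rewrite exprS => /dividesM[].
Qed.

Lemma prime_elt_neq0 : p != 0.
Proof. by case: hp. Qed.

Definition prime_multiples : {pred D} := [pred a | `[< divides p a >]].

Lemma prime_multiplesP a : reflect (divides p a) (a \in prime_multiples).
Proof. exact: asboolP. Qed.

Lemma prime_multiples_prime : prime_ideal prime_multiples.
Proof.
split; first split.
- exact/prime_multiplesP/divides0.
- by apply/prime_multiplesP/divides1.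
- move=> a u w /prime_multiplesP pu /prime_multiplesP pw.
  by apply/prime_multiplesP/dividesD => //; exact: divides_mull.
- move=> u w /prime_multiplesP/dividesM[] /prime_multiplesP -> //.
  by rewrite orbT.
Qed.

(** If no height-one prime contained [p], then 1/p would lie in every localization, hence in [D]. A
    height-one prime containing [p] contains the nonzero prime pD and equals it by minimality. *)
Lemma krull_height_one : krull_domain D -> height_one_prime prime_multiples.
Proof.
case=> _ inter _.
have [P hP pP] : exists2 P, height_one_prime P & p \in P.
  apply: contrapT => noP; have [|a ea] := inter (p%:F)^-1.
    move=> P hP; exists 1, p; split; last by rewrite tofrac1 mul1r.
    by apply/negP => pP; apply: noP; exists P.
  apply: divides1; exists a; apply/eqP; rewrite -tofrac_eq tofracM -ea.
  by rewrite divff ?tofrac_eq0 ?prime_elt_neq0 // tofrac1.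
case: (hP) => idP _ minP.
have sub : {subset prime_multiples <= P}.
  move=> a /prime_multiplesP[d ->]; case: idP => -[P0 _ Pl] _.
  by rewrite mulrC -[_ * _]addr0 Pl.
have -> // : prime_multiples = P.
have Qp : exists2 a, a \in prime_multiples & a != 0.
  exists p; last exact: prime_elt_neq0.
  by apply/prime_multiplesP; exists 1; rewrite mulr1.
by apply/funext => a; have := minP _ prime_multiples_prime Qp sub a.
Qed.

(** [v] belongs to the localization at pD. It vanishes off pD, where elements become invertible, and
    is positive at [p]: if 1/p = a/s, then s = p a, although [p] does not divide [s]. *)
Lemma krull_valuation : krull_domain D ->
  exists v : {fraction D} -> int, [/\ discrete_valuation v, v p%:F = 1 &
    forall d, ~ divides p d -> v d%:F = 0].
Proof.
move=> hD; have [dvr _ _] := hD.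
have := dvr _ (krull_height_one hD); rewrite /discrete_valuation_ring.
case=> v hv locE; exists v.
have inV a s : ~ divides p s -> a != 0 -> 0 <= v (a%:F / s%:F).
  move=> ps a0; have s0 : s != 0 by apply: contra_notN ps => /eqP->; exact: divides0.
  have : localization prime_multiples (a%:F / s%:F).
    by exists a, s; split=> //; apply/prime_multiplesP.
  rewrite locE => -[/eqP|[]//].
  by rewrite mulf_eq0 invr_eq0 !tofrac_eq0 (negPf a0) (negPf s0).
have unitV d : ~ divides p d -> v d%:F = 0.
  move=> pd; have d0 : d != 0 by apply: contra_notN pd => /eqP->; exact: divides0.
  have := inV d 1 divides1 d0; have := inV 1 d pd (oner_neq0 _).
  rewrite tofrac1 divr1 mul1r (valV hv) ?tofrac_eq0 //.
  by move: (v _) => x *; lia.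
have p0 := prime_elt_neq0; have pF0 : p%:F != 0 by rewrite tofrac_eq0.
split=> //; apply/eqP; rewrite eq_le; apply/andP; split; last first.
  have vp : 0 <= v p%:F by have := inV p 1 divides1 p0; rewrite tofrac1 divr1.
  have [v0|vp0] := eqVneq (v p%:F) 0; last first.
    by move: vp vp0; move: (v _) => *; lia.
  have : localization prime_multiples (p%:F)^-1.
    by rewrite locE /=; right; rewrite invr_neq0 // (valV hv) // v0 oppr0.
  case=> a [s [/prime_multiplesP ps e]]; case: ps; exists a; apply/eqP.
  have s0 : s != 0.
    apply: contra_eqN e => /eqP ->; rewrite tofrac0 invr0 mulr0.
    by rewrite invr_eq0.
  rewrite -tofrac_eq tofracM -(mulfK pF0 s%:F) -[a%:F](@divfK _ s%:F) ?tofrac_eq0 //.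
  by rewrite -e mulrA divff // mul1r -mulrA divff // mulr1.
(* Upper bound for the value of [p]: the numerator of an element of value 1 is a multiple of [p],
   with a cofactor of value at least 0. *)
case: (hv) => /(_ 1)[x x0 vx] _ _.
have : localization prime_multiples x by rewrite locE; right; rewrite vx.
case=> a [s [/prime_multiplesP ps ex]].
have s0 : s != 0 by apply: contra_notN ps => /eqP->; exact: divides0.
have vs := unitV _ ps.
have a0 : a != 0 by apply: contraNneq x0 => a0; rewrite ex a0 tofrac0 mul0r.
have va : v a%:F = 1.
  move: vx; rewrite ex (valM hv) ?invr_neq0 ?tofrac_eq0 //.
  by rewrite (valV hv) ?tofrac_eq0 // vs oppr0 addr0.
have [[d ad]|pa] := pselect (divides p a); last by rewrite unitV in va.
have d0 : d != 0 by apply: contraNneq a0 => d0; rewrite ad d0 mulr0.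
have := inV d 1 divides1 d0; rewrite tofrac1 divr1.
move: va; rewrite ad tofracM (valM hv) ?tofrac_eq0 //.
by move: (v _) (v _) => *; lia.
Qed.

End PrimeElement.

Lemma residue_system (D : idomainType) (p : D) :
  prime_elt p -> finite_set (cosets p) ->
  exists (C : finType) (L : C -> {poly D}) (cl : D -> C),
    [/\ (1 < #|C|)%N, forall c, size (L c) = 2,
        forall a c, divides p (L c).[a] <-> c = cl a,
        forall c, exists a, cl a = c &
        forall c, (L c).[0] = 0 \/ (L c).[0] = 1].
Proof.
move=> hp /finite_seqP[s Es].
pose coset x : set D := [set x + p * d | d in [set: D]]%classic.
have coset_in x : coset x \in s.
  by have : cosets p (coset x) by [exists x]; rewrite Es.
pose cl0 x : seq_sub s := SeqSub (coset_in x).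
have cl0P x y : cl0 x = cl0 y <-> divides p (x - y).
  split=> [/(congr1 val) /= e | [d e]].
    have : coset x x by exists 0; rewrite // mulr0 addr0.
    by rewrite e => -[d _ <-]; exists d; rewrite addrAC subrr add0r.
  apply/val_inj/seteqP; split=> z [f _ <-] /=.
    by exists (d + f) => //; rewrite mulrDr -e addrA subrKC.
  by exists (f - d) => //; rewrite mulrBr -e opprB addrCA subrKC addrC.
have rep0 (c : seq_sub s) : exists x, cl0 x = c.
  have : cosets p (val c) by rewrite Es; exact: valP.
  by case=> x _ e; exists x; exact/val_inj.
have [rep repK] := choice rep0.
have inv0 a : exists b, ~ divides p a -> divides p (1 - b * a).
  have [pa|pa] := pselect (divides p a); first by exists 0.
  (* Multiplication by [a] is injective on the finite set of classes, hence onto, so it reaches the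
     class of 1. *)
  have inj : injective (fun c => cl0 (a * rep c)).
    move=> c c' /cl0P; rewrite -mulrBr => /(dividesM hp)[//|/cl0P].
    by rewrite !repK.
  have := codomP (injF_onto inj (cl0 1)).
  case=> c /cl0P pc; exists (rep c); by rewrite mulrC.
have [inv invP] := choice inv0.
(* Outside the zero class 1 - r X is used instead of X - a, with r inverse to a
   modulo p, because its value at 0 is a unit of D. *)
pose lin (c : seq_sub s) : {poly D} :=
  if c == cl0 0 then 'X else 1 - rep c *: 'X.
(* A nonzero residue class is labelled by the coset of its inverse, because 1 - r a is divisible by
   [p] exactly when r inverts [a] modulo [p]. *)
pose cl a := if pselect (divides p a) then cl0 0 else cl0 (inv a).
exists (seq_sub s), lin, cl.
have ev c a : (lin c).[a] = if c == cl0 0 then a else 1 - rep c * a.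
  by rewrite /lin; case: ifP => _; rewrite !hornerE.
have rep_c0 c : c = cl0 0 <-> divides p (rep c).
  by rewrite -{1}[c]repK cl0P subr0.
have evP a c : divides p (lin c).[a] <-> c = cl a.
  rewrite ev /cl; case: pselect => pa.
    case: eqP => // c0; split=> // h; case: (divides1 hp).
    by rewrite -(subrK (rep c * a) 1); apply: dividesD => //; exact: divides_mull.
  have cinv : cl0 (inv a) <> cl0 0.
    move=> /cl0P; rewrite subr0 => pi; case: (divides1 hp).
    rewrite -(subrK (inv a * a) 1); apply: dividesD (invP a pa) _.
    exact: divides_mulr.
  case: eqP => [->|c0]; first by split=> // e; case: cinv.
  have e1 : 1 - inv a * a - (1 - rep c * a) = (rep c - inv a) * a.
    by rewrite mulrBl opprB addrC addrA subrK.
  rewrite -{2}[c]repK cl0P; split=> h.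
    have /(dividesM hp)[] // : divides p ((rep c - inv a) * a).
    by rewrite -e1; apply: dividesD (invP a pa) _; exact: dividesN.
  have -> : 1 - rep c * a = 1 - inv a * a - (rep c - inv a) * a.
    by rewrite -e1 opprB subrKC.
  by apply: dividesD (invP a pa) _; apply/dividesN/divides_mulr.
split=> // [|c|c|c].
- have ne : cl0 1 != cl0 0 by apply/eqP => /cl0P; rewrite subr0 => /(divides1 hp).
  by rewrite (cardD1 (cl0 0)) (cardD1 (cl0 1)) !inE ne.
- rewrite /lin; case: eqP => [_|c0]; first exact: size_polyX.
  have r0 : rep c != 0.
    by apply: contra_notN c0 => /eqP r0; apply/rep_c0; rewrite r0; exact: divides0.
  rewrite addrC size_polyDl size_polyN size_scale // ?size_polyX ?size_poly1 //.
- have [->|c0] := eqVneq c (cl0 0).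
    by exists 0; rewrite /cl; case: pselect => // -[]; exact: divides0.
  exists (inv (rep c)); apply/esym/evP; rewrite ev (negPf c0) mulrC; apply: invP.
  by move/rep_c0/eqP; rewrite (negPf c0).
- by rewrite ev; case: ifP => _; [left | right]; rewrite ?mulr0 ?subr0.
Qed.

(** * Tight sets of polynomials *)

Section IrreducibleProducts.
Variables (F : fieldType) (I : finType) (G : I -> {poly F}).
Hypothesis Girr : forall i, irreducible_poly (G i).

Lemma irreducible_dvdpM (g u w : {poly F}) :
  irreducible_poly g -> g %| u * w -> (g %| u) || (g %| w).
Proof.
move=> irr_g g_uw; have [//|/= ndvd] := boolP (g %| u).
have co : coprimep g u.
  rewrite /coprimep; apply: contraNT ndvd => s1.
  by have /eqp_dvdl <- := irr_g.2 _ s1 (dvdp_gcdl g u); exact: dvdp_gcdr.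
by rewrite -(Gauss_dvdpr w co).
Qed.

Lemma irreducible_dvdp_prod (g : {poly F}) (A : {set I}) :
  irreducible_poly g -> g %| \prod_(i in A) G i ->
  exists2 i, i \in A & g %| G i.
Proof.
move=> irr_g; elim/big_ind: _ => [g1|u w IHu IHw|i iA ?]; last by exists i.
- by case: irr_g; rewrite dvdp1 in g1; rewrite (eqP g1).
- by move=> /(irreducible_dvdpM irr_g)/orP[].
Qed.

(** Induction on [#|T|]: some [G i] divides one of the two factors and is cancelled from it. *)
Lemma factor_irreducible_prod (T : {set I}) (u w : {poly F}) (k : F) :
  k != 0 -> u * w = k *: \prod_(i in T) G i ->
  exists A : {set I}, exists k1, exists k2, [/\ A \subset T, k1 != 0, k2 != 0,
    u = k1 *: \prod_(i in A) G i & w = k2 *: \prod_(i in T :\: A) G i].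
Proof.
move=> k0; have [n] := ubnP #|T|; elim: n => // n IHn in T u w *.
rewrite ltnS => leTn; have [->|/set0Pn[i iT]] := eqVneq T set0.
  rewrite big_set0 => uw.
  have : size (u * w) == 1%N by rewrite uw alg_polyC size_polyC k0.
  rewrite size_mul_eq1 => /andP[/size_poly1P[k1 k10 ->] /size_poly1P[k2 k20 ->]].
  exists set0, k1, k2; rewrite sub0set setD0 k10 k20.
  by split=> //; rewrite big_set0 alg_polyC.
move=> uw; have Gi0 := irredp_neq0 (Girr i).
have cardTi : (#|T :\ i| < n)%N.
  by rewrite (cardsD1 i T) iT add1n in leTn.
have uw' : u * w = G i * (k *: \prod_(j in T :\ i) G j).
  by rewrite uw (big_setD1 i) //= scalerAr.
have /(irreducible_dvdpM (Girr i))/orP[/dvdpP[u' eu]|/dvdpP[w' ew]] :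
    G i %| u * w by rewrite uw' dvdp_mulIl.
- have [|A [k1 [k2 [sA k10 k20 eu' ->]]]] := IHn (T :\ i) u' w cardTi.
    by apply: (mulfI Gi0); rewrite -uw' eu mulrA (mulrC u').
  have iA : i \notin A by apply/negP => /(subsetP sA); rewrite setD11.
  exists (i |: A), k1, k2; split=> //.
  - by rewrite subUset sub1set iT (subset_trans sA) // subsetDl.
  - by rewrite eu eu' big_setU1 //= -scalerAl mulrC.
  - by rewrite -setDDl.
- have [|A [k1 [k2 [sA k10 k20 -> ew']]]] := IHn (T :\ i) u w' cardTi.
    by apply: (mulfI Gi0); rewrite -uw' ew mulrCA (mulrC w').
  have iA : i \notin A by apply/negP => /(subsetP sA); rewrite setD11.
  exists A, k1, k2; split=> //; first by rewrite (subset_trans sA) // subsetDl.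
  rewrite ew ew' [in RHS](big_setD1 i) /=; last by rewrite in_setD iA iT.
  rewrite -scalerAl mulrC; congr (_ *: (_ * _)).
  by apply: eq_bigl => j; rewrite !inE andbCA.
Qed.

End IrreducibleProducts.

Section Associated.
Variable R : idomainType.
Implicit Types r s t : R.

Lemma associated_refl r : associated r r.
Proof. by exists 1; rewrite ?unitr1 ?mul1r. Qed.

Lemma associated_sym r s : associated r s -> associated s r.
Proof. by case=> e ue ->; exists e^-1; rewrite ?unitrV // mulKr. Qed.

Lemma associated_trans r s t : associated r s -> associated s t -> associated r t.
Proof.
by case=> e ue -> [f uf ->]; exists (e * f); rewrite ?unitrM ?ue // mulrA.
Qed.

Lemma associated_unit r s :
  associated r s -> (r \is a GRing.unit) = (s \is a GRing.unit).
Proof. by case=> e ue ->; rewrite unitrM ue. Qed.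

Lemma irreducible_associated r s :
  associated r s -> irreducible_elt r -> irreducible_elt s.
Proof.
move=> rs [r0 ur irr]; have [e ue er] := associated_sym rs; split.
- by rewrite er mulf_neq0 //; apply: contraTneq ue => ->; rewrite unitr0.
- by rewrite -(associated_unit rs).
- move=> b c es; have : r = e^-1 * b * c by rewrite -mulrA -es er mulKr.
  by move/irr; rewrite unitrM unitrV ue.
Qed.

End Associated.

(** * Normalized products over tight sets and their factors in Int(D) *)

Section Blocks.
Variables (D : idomainType) (p : D) (v : {fraction D} -> int).
Hypotheses (hp : prime_elt p) (hv : discrete_valuation v) (vp : v p%:F = 1)
  (v_ndvd : forall d, ~ divides p d -> v d%:F = 0).
Variables (C I : finType) (cl : D -> C) (F : I -> {poly D}) (wt : C -> I -> nat).
Local Notation FK i := (map_poly (@tofrac D) (F i)).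
Hypotheses (cl_surj : forall c, exists a, cl a = c)
  (Firr : forall i, irreducible_poly (FK i))
  (Fval : forall i a, exists2 d, ~ divides p d & (F i).[a] = d * p ^+ wt (cl a) i)
  (Fval0 : forall i, exists2 d, d \is a GRing.unit &
                               (F i).[0] = d * p ^+ wt (cl 0) i).
Implicit Types (A B T : {set I}) (f : {poly {fraction D}}).

(** The p-adic valuation of the product of the [F i] over [A] at any point of class [c]. *)
Definition total c A : nat := \sum_(i in A) wt c i.

(** The condition under which division by one power of [p] makes all values on [D] prime to [p]. *)
Definition tight A : bool := [forall c, total c A == total (cl 0) A].

(** The default 0 of [insubd] does not occur for tight [A], where the polynomial is
    integer-valued. *)
Definition block A : Int D :=
  insubd (0 : Int D) ((p%:F ^- total (cl 0) A) *: \prod_(i in A) FK i).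

Let pF0 : p%:F != 0. Proof. by rewrite tofrac_eq0 (prime_elt_neq0 hp). Qed.

Let ndvd_neq0 d : ~ divides p d -> d != 0.
Proof. by move=> pd; apply: contra_notN pd => /eqP->; exact: divides0. Qed.

Lemma tightP A : reflect (forall c, total c A = total (cl 0) A) (tight A).
Proof. by apply: (iffP forallP) => h c; apply/eqP; rewrite h. Qed.

Lemma horner_tofrac (f : {poly D}) a : (map_poly (@tofrac D) f).[a%:F] = f.[a]%:F.
Proof. by rewrite horner_map. Qed.

Lemma prod_val A a : exists2 d, ~ divides p d &
  (\prod_(i in A) FK i).[a%:F] = (d * p ^+ total (cl a) A)%:F.
Proof.
rewrite /total; elim/big_rec2: _ => [|i n f iA [d pd ed]].
  by exists 1; [exact: divides1 | rewrite hornerC mulr1 tofrac1].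
have [d' pd' ed'] := Fval i a; exists (d' * d); first by case/(dividesM hp).
by rewrite hornerM ed horner_tofrac ed' -tofracM exprD mulrACA.
Qed.

Lemma prod_val0 A : exists2 d, d \is a GRing.unit &
  (\prod_(i in A) FK i).[0%:F] = (d * p ^+ total (cl 0) A)%:F.
Proof.
rewrite /total; elim/big_rec2: _ => [|i n f iA [d ud ed]].
  by exists 1; rewrite ?unitr1 // hornerC mulr1 tofrac1.
have [d' ud' ed'] := Fval0 i; exists (d' * d); first by rewrite unitrM ud'.
by rewrite hornerM ed horner_tofrac ed' -tofracM exprD mulrACA.
Qed.

Lemma blockE A : tight A ->
  int_poly (block A) = (p%:F ^- total (cl 0) A) *: \prod_(i in A) FK i.
Proof.
move=> /tightP tA; rewrite -[int_poly _]/(val _) insubdK //; apply/int_valuedP => a.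
have [d _ ed] := prod_val A a; exists d.
by rewrite hornerZ ed tA tofracM tofracXn mulrCA mulVf ?mulr1 // expf_neq0.
Qed.

(** Both conditions pass to factors in Int(D). The first leads to tightness, the second keeps other
    primes of [D] out of the constant. *)
Definition primitive_values f : Prop :=
  (forall a, exists2 d, ~ divides p d & f.[a%:F] = d%:F) /\
  (exists2 d, d \is a GRing.unit & f.[0%:F] = d%:F).

Lemma block_primitive A : tight A -> primitive_values (block A).
Proof.
move=> tA; split=> [a|].
  have [d pd ed] := prod_val A a; exists d => //; rewrite blockE // hornerZ ed.
  by rewrite (tightP _ tA) tofracM tofracXn mulrCA mulVf ?mulr1 // expf_neq0.
have [d ud ed] := prod_val0 A; exists d => //; rewrite blockE // hornerZ ed.
by rewrite tofracM tofracXn mulrCA mulVf ?mulr1 // expf_neq0.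
Qed.

Lemma primitive_valuesMl (f g : Int D) :
  primitive_values (f * g) -> primitive_values f.
Proof.
case=> vals [d0 ud0 e0]; split=> [a|].
  have [d pd ed] := vals a.
  have /int_valuedP/(_ a)[d1 e1] := int_polyP f.
  have /int_valuedP/(_ a)[d2 e2] := int_polyP g.
  exists d1 => //; apply: contra_not pd => pd1.
  suff -> : d = d1 * d2 by exact: divides_mulr.
  by apply/eqP; rewrite -tofrac_eq -ed tofracM -e1 -e2 -hornerM.
have /int_valuedP/(_ 0)[d1 e1] := int_polyP f.
have /int_valuedP/(_ 0)[d2 e2] := int_polyP g.
exists d1 => //; suff d12 : d0 = d1 * d2 by move: ud0; rewrite d12 unitrM => /andP[].
by apply/eqP; rewrite -tofrac_eq -e0 tofracM -e1 -e2 -hornerM.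
Qed.

(** All values of [u] have valuation 0, so [total c A] is minus the valuation of [k] for every [c].
    Comparing [u] with [block A] at 0, where both values are units, shows that [k] is a unit of [D]
    times a power of [p]. *)
Lemma primitive_tight A (k : {fraction D}) (u : Int D) : k != 0 ->
  int_poly u = k *: \prod_(i in A) FK i -> primitive_values u ->
  tight A /\ associated u (block A).
Proof.
move=> k0 eu [vals [d ud ed]].
have vk c : v k + (total c A)%:Z = 0.
  have [a <-] := cl_surj c; have [d1 pd1 e1] := vals a.
  have [d2 pd2 e2] := prod_val A a.
  have := v_ndvd pd1; rewrite -e1 eu hornerZ e2 tofracM tofracXn.
  rewrite !(valM hv) ?mulf_neq0 ?expf_neq0 ?pF0 ?tofrac_eq0 ?ndvd_neq0 //.
  by rewrite (v_ndvd pd2) (valX hv) // vp add0r natz.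
have tA : tight A.
  by apply/tightP => c; apply/eqP; rewrite -eqz_nat -(inj_eq (addrI (v k))) !vk.
split=> //; have [_ [d1 ud1 e1]] := block_primitive tA.
pose n := total (cl 0) A; pose e := d / d1.
have ue : e \is a GRing.unit by rewrite unitrM ud unitrV.
have ke : k = e%:F * p%:F ^- n.
  have d10 : d1%:F != 0.
    by rewrite tofrac_eq0; apply: contraTneq ud1 => ->; rewrite unitr0.
  apply: (mulIf d10); rewrite mulrAC -tofracM divrK // -ed eu -e1 blockE //.
  by rewrite !hornerZ mulrCA mulrC.
have constI (x : D) : x%:F%:P \in int_valued D.
  by apply/int_valuedP => a; exists x; rewrite hornerC.
have : (MkInt (constI e)) \is a GRing.unit.
  apply/unitrPr; exists (MkInt (constI e^-1)); apply/val_inj => /=.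
  rewrite -[LHS]/(e%:F%:P * (e^-1)%:F%:P).
  by rewrite -polyCM -tofracM mulrV // tofrac1.
exists (MkInt (constI e)) => //; apply/val_inj => /=.
rewrite -[RHS]/(e%:F%:P * int_poly (block A)) blockE // eu ke.
by rewrite mul_polyC scalerA.
Qed.

(** The factorization in K[X] splits the index set [T]; both factors inherit primitive values from
    [block T]. *)
Lemma block_factor T (u w : Int D) : tight T -> block T = u * w ->
  exists A, [/\ A \subset T, tight A, tight (T :\: A),
    associated u (block A) & associated w (block (T :\: A))].
Proof.
move=> tT e.
have euw : int_poly u * int_poly w = (p%:F ^- total (cl 0) T) *: \prod_(i in T) FK i.
  by rewrite -blockE // e.
have k0 : p%:F ^- total (cl 0) T != 0 by rewrite invr_eq0 expf_neq0.
have [A [k1 [k2 [sA k10 k20 eu ew]]]] := factor_irreducible_prod Firr k0 euw.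
have prim := block_primitive tT; rewrite e in prim.
have [tA au] := primitive_tight k10 eu (primitive_valuesMl prim).
rewrite [u * w]mulrC in prim.
have [tTA aw] := primitive_tight k20 ew (primitive_valuesMl prim).
by exists A.
Qed.

Lemma tight0 : tight set0.
Proof. by apply/tightP => c; rewrite /total !big_set0. Qed.

Lemma block0 : block set0 = 1.
Proof.
apply/val_inj; rewrite /= blockE ?tight0 // /total !big_set0 expr0 invr1 scale1r.
by [].
Qed.

Lemma totalD c T A : A \subset T -> (total c A + total c (T :\: A))%N = total c T.
Proof. by move=> /setIidPr sA; rewrite [RHS](big_setID A) /= sA. Qed.

Lemma blockD T A : tight T -> tight A -> A \subset T ->
  tight (T :\: A) /\ block T = block A * block (T :\: A).
Proof.
move=> tT tA sA.
have tD : tight (T :\: A).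
  apply/tightP => c; apply: (@addnI (total c A)).
  by rewrite {2}(tightP _ tA) !totalD // (tightP _ tT).
split=> //; apply/val_inj.
rewrite -[RHS]/(int_poly (block A) * int_poly (block (T :\: A))) /= !blockE //.
rewrite -(totalD _ sA) -scalerAl -scalerAr scalerA exprD invfM.
by rewrite [in LHS](big_setID A) /= (setIidPr sA).
Qed.

Lemma block_unit A : tight A -> block A \is a GRing.unit -> A = set0.
Proof.
move=> tA /unitrPr[g /(congr1 (@int_poly D))].
rewrite -[LHS]/(int_poly (block A) * int_poly g) blockE // => e.
apply/eqP; apply: contraT => /set0Pn[i iA].
have : FK i %| int_poly (1 : Int D).
  by rewrite -e -scalerAl (big_setD1 i) //= -mulrA scalerAr dvdp_mulIl.
by rewrite dvdp1 => /eqP s1; have [+ _] := Firr i; rewrite s1.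
Qed.

Lemma block_neq0 A : tight A -> block A != 0.
Proof.
move=> tA; have [_ [d ud ed]] := block_primitive tA.
apply: contraTneq ud => A0; suff /eqP : d%:F = 0.
  by rewrite tofrac_eq0 => /eqP ->; rewrite unitr0.
by rewrite -ed A0 -[LHS]/((0 : {poly {fraction D}}).[0%:F]) horner0.
Qed.

(** A unit of Int(D) divides 1 in K[X], so an irreducible [FK i] dividing [block A] must divide some
    [FK j] with [j] in [B]. *)
Lemma associated_block_sub A B : (forall i j, FK i %= FK j -> i = j) ->
  tight A -> tight B -> associated (block A) (block B) -> A \subset B.
Proof.
move=> Finj tA tB [e /unitrPr[e' /(congr1 (@int_poly D)) eu]].
move=> /(congr1 (@int_poly D)); rewrite -[LHS]/(int_poly e * int_poly e') in eu.
rewrite -[RHS]/(int_poly e * int_poly (block B)) !blockE // => eAB.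
apply/subsetP => i iA.
have nz T : p%:F ^- total (cl 0) T != 0 by rewrite invr_eq0 expf_neq0.
have : FK i %| p%:F ^- total (cl 0) A *: \prod_(i in A) FK i.
  by rewrite dvdpZr ?nz // (big_setD1 i) //= dvdp_mulIl.
rewrite eAB => /(irreducible_dvdpM (Firr i))/orP[i_e|].
  have : FK i %| int_poly e * int_poly e' by rewrite dvdp_mulr.
  by rewrite eu dvdp1 => /eqP s1; have [+ _] := Firr i; rewrite s1.
rewrite dvdpZr // => /(irreducible_dvdp_prod (Firr i))[j jB i_j].
have [si _] := Firr i; have := (Firr j).2 _ (negbT (gtn_eqF si)) i_j.
by move/Finj => ->.
Qed.

End Blocks.

(** * Irreducible polynomials with prescribed values *)

(** Substituting a linear polynomial is an automorphism of F[X]; [r] below gives its inverse. *)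
Lemma irreducible_comp_poly2 (F : fieldType) (f q : {poly F}) :
  size q = 2 -> irreducible_poly f -> irreducible_poly (f \Po q).
Proof.
move=> sq [sf irr]; split=> [|g sg /dvdpP[h e]]; first by rewrite size_comp_poly2.
have q1 : q`_1 != 0.
  by have := lead_coef_eq0 q; rewrite lead_coefE -size_poly_eq0 sq => ->.
have Eq : q = q`_1 *: 'X + (q`_0)%:P.
  apply/polyP => -[|[|i]]; rewrite !coefE ?mulr0 ?add0r ?mulr1 ?addr0 //.
  by rewrite nth_default ?sq.
pose r := (q`_1)^-1 *: ('X - (q`_0)%:P).
have sr : size r = 2 by rewrite size_scale ?invr_eq0 // size_XsubC.
have qr : q \Po r = 'X.
  rewrite Eq comp_polyD comp_polyZ comp_polyX comp_polyC.
  by rewrite scalerA divff // scale1r subrK.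
have ef : f = (h \Po r) * (g \Po r).
  by rewrite -comp_polyM -e -comp_polyA qr comp_polyXr.
have /eqp_size : g \Po r %= f.
  by apply: irr; rewrite ?size_comp_poly2 // [X in _ %| X]ef dvdp_mulIr.
rewrite size_comp_poly2 // => s_gf.
by rewrite -dvdp_size_eqp ?size_comp_poly2 ?s_gf // e dvdp_mulIr.
Qed.

Section BasePolynomials.
Variables (D : idomainType) (p : D) (v : {fraction D} -> int).
Hypotheses (hp : prime_elt p) (hv : discrete_valuation v) (vp : v p%:F = 1)
  (v_ndvd : forall d, ~ divides p d -> v d%:F = 0).

(** For b > 0 the Newton polygon is the segment from (0, b) to (b+1, 0). If [p] divides y, then
    y^(b+1) is divisible by p^(b+1) and the rest has valuation exactly b; otherwise the value is
    prime to [p]. The values at 0 and 1 are -p^b and 1, units times powers of [p]. *)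
Definition base_poly (b : nat) : {poly D} := 'X^(b.+1) + p ^+ b *: ('X - 1).

Lemma base_polyE b y : (base_poly b).[y] = y ^+ b.+1 + p ^+ b * (y - 1).
Proof. by rewrite !hornerE. Qed.

Lemma base_poly_irreducible b : (0 < b)%N ->
  irreducible_poly (map_poly (@tofrac D) (base_poly b)).
Proof.
move=> b0; set f := map_poly _ _.
have pF0 : p%:F != 0 by rewrite tofrac_eq0 (prime_elt_neq0 hp).
have Ef : f = 'X^(b.+1) + p%:F ^+ b *: ('X - 1).
  by rewrite /f rmorphD /= map_polyXn map_polyZ rmorphB /= map_polyX rmorph1 rmorphXn.
have lt_s : (size (p%:F ^+ b *: ('X - 1)) < size ('X^(b.+1) : {poly {fraction D}}))%N.
  by rewrite size_polyXn size_scale ?expf_neq0 // -polyC1 size_XsubC; lia.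
have cf i : f`_i = (i == b.+1)%:R + p%:F ^+ b * ((i == 1)%:R - (i == 0)%:R).
  by rewrite Ef coefD coefXn coefZ coefB coefX coef1.
apply: (newton_irreducible hv (n := b.+1) (b := b)) => //.
- exact: coprimeSn.
- by rewrite Ef size_polyDl // size_polyXn.
- by rewrite Ef lead_coefDl // lead_coefXn (val1 hv).
- by rewrite cf /= add0r sub0r mulrN1 oppr_eq0 expf_neq0.
- by rewrite cf /= add0r sub0r mulrN1 (valN hv) ?expf_neq0 // (valX hv) // vp natz.
- move=> i; rewrite /weight cf; have [->|ib] := eqVneq i b.+1.
    case: b b0 {Ef lt_s cf f} => // b _ _.
    rewrite subrr mulr0 addr0 (val1 hv) mul0rn add0r; lia.
  rewrite add0r; case: i ib => [|[|i]] ib /=.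
  - rewrite sub0r mulrN1 (valN hv) ?expf_neq0 // (valX hv) // vp natz => _.
    by rewrite muln0 addr0 -mulr_natr natz -PoszM mulnC.
  - rewrite subr0 mulr1 (valX hv) // vp natz => _.
    by rewrite -mulr_natr natz -PoszM mulnC lerDl.
  - by rewrite subrr mulr0 eqxx.
Qed.

Lemma base_poly_divides b y : (0 < b)%N -> divides p y ->
  exists2 d, ~ divides p d & (base_poly b).[y] = d * p ^+ b.
Proof.
move=> b0 [z ez]; exists (y * z ^+ b + (y - 1)).
  move=> pd; apply: (divides1 hp).
  have -> : 1 = y * (z ^+ b + 1) - (y * z ^+ b + (y - 1)).
    by rewrite mulrDr mulr1 addrA opprB addrCA subrr addr0.
  by apply: dividesD; [apply: divides_mulr; exists z | exact: dividesN].
rewrite base_polyE mulrDl [p ^+ b * _]mulrC; congr (_ + _).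
by rewrite exprS {2}ez exprMn -mulrA [z ^+ b * _]mulrC.
Qed.

Lemma base_poly_ndivides b y : (0 < b)%N -> ~ divides p y ->
  ~ divides p (base_poly b).[y].
Proof.
move=> b0 py; rewrite base_polyE => pd; apply: py; apply: (@dividesX _ _ hp _ b.+1).
rewrite -(addrK (p ^+ b * (y - 1)) (y ^+ b.+1)); apply: dividesD => //.
apply/dividesN/divides_mulr; exists (p ^+ b.-1).
by rewrite -exprS prednK.
Qed.

Variables (C E : finType) (L : C -> {poly D}) (cl : D -> C) (b : E * C -> nat).
Hypotheses (C1 : (1 < #|C|)%N) (sL : forall c, size (L c) = 2)
  (LP : forall a c, divides p (L c).[a] <-> c = cl a)
  (clS : forall c, exists a, cl a = c)
  (L0 : forall c, (L c).[0] = 0 \/ (L c).[0] = 1)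
  (b0 : forall i, (0 < b i)%N)
  (b_inj : forall c z w, b (z, c) = b (w, c) -> z = w).
Implicit Types i j : E * C.

Definition grid_poly i : {poly D} := base_poly (b i) \Po L i.2.

Definition grid_val (c : C) i : nat := if i.2 == c then b i else 0.

Lemma grid_poly_irreducible i : irreducible_poly (map_poly (@tofrac D) (grid_poly i)).
Proof.
rewrite map_comp_poly; apply: irreducible_comp_poly2.
  rewrite size_map_inj_poly ?tofrac0 // => x y /eqP.
  by rewrite tofrac_eq => /eqP.
exact: base_poly_irreducible.
Qed.

Lemma grid_poly_val i a : exists2 d, ~ divides p d &
  (grid_poly i).[a] = d * p ^+ grid_val (cl a) i.
Proof.
rewrite /grid_val horner_comp; case: eqP => [ci|nci].
  by apply: base_poly_divides => //; apply/LP.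
exists (base_poly (b i)).[(L i.2).[a]]; last by rewrite mulr1.
by apply: base_poly_ndivides => // /LP.
Qed.

Lemma grid_poly_val0 i : exists2 d, d \is a GRing.unit &
  (grid_poly i).[0] = d * p ^+ grid_val (cl 0) i.
Proof.
rewrite /grid_val horner_comp base_polyE; have := LP 0 i.2.
case: (L0 i.2) => -> P.
  rewrite (P.1 (divides0 p)) eqxx; exists (-1); rewrite ?unitrN1 //.
  by rewrite expr0n add0r sub0r mulrC.
case: eqP => [/P/(divides1 hp)//|_]; exists 1; first exact: unitr1.
by rewrite subrr mulr0 addr0 expr1n mulr1.
Qed.

(** A constant ratio shifts the valuations by the same amount in all classes. Each polynomial has
    positive valuation in one class only, and there are at least two classes, so the shift is 0 and
    class and weight agree. *)
Lemma grid_poly_inj i j :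
  map_poly (@tofrac D) (grid_poly i) %= map_poly (@tofrac D) (grid_poly j) -> i = j.
Proof.
move=> /eqpP[[k1 k2] /= /andP[k10 k20] e].
have pF0 : p%:F != 0 by rewrite tofrac_eq0 (prime_elt_neq0 hp).
have vk c : v k1 + (grid_val c i)%:Z = v k2 + (grid_val c j)%:Z.
  have [a <-] := clS c.
  have := congr1 (fun f => v f.[a%:F]) e; rewrite !hornerZ !horner_tofrac.
  have [d1 pd1 ->] := grid_poly_val i a; have [d2 pd2 ->] := grid_poly_val j a.
  have nz d : ~ divides p d -> d%:F != 0.
    by move=> pd; rewrite tofrac_eq0; apply: contra_notN pd => /eqP->; exact: divides0.
  rewrite !tofracM !tofracXn !(valM hv) ?mulf_neq0 ?expf_neq0 ?pF0 ?nz //.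
  by rewrite !(v_ndvd pd1, v_ndvd pd2) !(valX hv) // vp !natz !add0r.
have other (c : C) : exists c', c' != c.
  move: C1; rewrite (cardD1 c) ltnS => /card_gt0P[c'].
  by rewrite !inE andbT; exists c'.
case: i j {e} vk => [z c] [w c'] vk; have := b0 (z, c); have := b0 (w, c').
have [ecc'|cc'] := eqVneq c c'; last first.
  have := vk c; have := vk c'.
  rewrite /grid_val /= !eqxx (negPf cc') eq_sym (negPf cc').
  by move: (v k1) (v k2) => *; lia.
subst c'; have [c' /negPf c'c] := other c; have := vk c; have := vk c'.
rewrite /grid_val /= eqxx eq_sym c'c !addr0 => -> /addrI[e] _ _.
by rewrite (b_inj e).
Qed.

End BasePolynomials.

(** * Weights on a grid *)

Section SeparatingWeight.
Variable T : finType.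
Implicit Types (f g x : T -> int).

Lemma pairing_bound f x : (forall t, `|x t| <= 1) ->
  `|\sum_t x t * f t| <= \sum_t `|f t|.
Proof.
move=> x1; apply: le_trans (ler_norm_sum _ _ _) _; apply: ler_sum => t _.
by rewrite normrM -[leRHS]mul1r ler_wpM2r.
Qed.

(** As for digits in base [N]: the pairing with [f] is smaller than [N] in absolute value and cannot
    cancel a nonzero multiple of [N]. *)
Lemma combine_pairings f g N x : (forall t, `|x t| <= 1) -> \sum_t `|f t| < N ->
  \sum_t x t * (f t + N * g t) = 0 <->
  \sum_t x t * f t = 0 /\ \sum_t x t * g t = 0.
Proof.
move=> x1 ltN; have lt_f := le_lt_trans (pairing_bound f x1) ltN.
have -> : \sum_t x t * (f t + N * g t) = \sum_t x t * f t + N * \sum_t x t * g t.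
  by rewrite mulr_sumr -big_split /=; apply: eq_bigr => t _; rewrite mulrDr mulrCA.
move: (\sum_t x t * f t) (\sum_t x t * g t) lt_f => a b lt_a.
split=> [e|[-> ->]]; last by rewrite mulr0 addr0.
have [b0|nb0] := eqVneq b 0; first by move: e; rewrite b0 mulr0 addr0.
have : N <= `|N * b|.
  by rewrite normrM (le_trans (ler_norm N)) // ler_peMr //; move: nb0; lia.
by rewrite leNgt (_ : `|N * b| = `|a|) ?lt_a //; lia.
Qed.

Lemma combine_all_pairings (I : eqType) (s : seq I) (d : I -> T -> int) :
  exists f, forall x, (forall t, `|x t| <= 1) ->
    \sum_t x t * f t = 0 <-> forall i, i \in s -> \sum_t x t * d i t = 0.
Proof.
elim: s => [|i s [f fP]].
  exists (fun=> 0) => x _; split=> // _.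
  by rewrite big1 // => t _; rewrite mulr0.
(* The factor of [f] exceeds the sum of the absolute values of [d i], as [combine_pairings]
   requires. *)
exists (fun t => d i t + (\sum_t `|d i t| + 1) * f t) => x x1.
rewrite combine_pairings // ?ltrDl // fP //; split=> [[di ds] j|ds].
  by rewrite inE => /predU1P[->|/ds].
by split=> [|j js]; apply: ds; rewrite inE ?eqxx ?js ?orbT.
Qed.

(** All equations are packed into one function [f]; adding a large constant makes it positive and
    contributes the equation that the entries of [x] sum to 0. *)
Lemma separating_weight (I : finType) (d : I -> T -> int) :
  exists b : T -> nat, (forall t, 0 < b t)%N /\
    forall x, (forall t, `|x t| <= 1) ->
      \sum_t x t * (b t)%:Z = 0 <->
      \sum_t x t = 0 /\ forall i, \sum_t x t * d i t = 0.
Proof.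
have [f fP] := combine_all_pairings (enum I) d.
pose N : int := \sum_t `|f t| + 1; pose g t : int := f t + N * 1.
have pos t : 0 < g t.
  have : `|f t| <= \sum_t `|f t| by rewrite (bigD1 t) //= lerDl sumr_ge0.
  by rewrite /g mulr1 /N; move: (\sum_t _) (f t) => *; lia.
exists (fun t => `|g t|%N); split=> [t|x x1]; first by rewrite absz_gt0 gt_eqF.
under eq_bigr => t _ do rewrite gez0_abs ?(ltW (pos t)) //.
rewrite combine_pairings // ?ltrDl // fP //.
under [in X in _ /\ X <-> _]eq_bigr => t _ do rewrite mulr1.
by split=> [[fs x0]|[x0 fs]]; split=> // i; rewrite ?fs ?mem_enum.
Qed.

End SeparatingWeight.

(** * Characterization of unions of parallel slices *)

Section Grid.
Variables (k : nat) (n : 'I_k -> nat).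
Local Notation E := {dffun forall h : 'I_k, 'I_(n h)}.
Implicit Types (y z w : E) (h : 'I_k).

Definition mix h w z : E := [ffun j => if j == h then w j else z j].

Lemma mixE h w z j : mix h w z j = if j == h then w j else z j.
Proof. exact: ffunE. Qed.

(** Linear equations expressing that the indicator of [A] is a sum of functions of one coordinate
    each. *)
Definition exchange_invariant (A : {set E}) : Prop := forall h z w,
  ((z \in A) + (w \in A) = (mix h w z \in A) + (mix h z w \in A))%N.

Lemma slice_exchange_invariant h (J : {set 'I_(n h)}) :
  exchange_invariant [set z : E | z h \in J].
Proof.
move=> h' z w; rewrite !inE !mixE; by case: eqP => // _; exact: addnC.
Qed.

Lemma stable_coordinates (A : {set E}) :
  (forall h z w, (mix h w z \in A) = (z \in A)) ->
  forall z w, (w \in A) = (z \in A).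
Proof.
move=> stab z w.
(* Passes from [z] to [w] one coordinate at a time. *)
pose y m : E := [ffun j : 'I_k => if (j < m)%N then w j else z j].
have y_A m : (m <= k)%N -> (y m \in A) = (z \in A).
  elim: m => [_|m IHm lt_mk].
    by congr (_ \in A); apply/ffunP => j; rewrite ffunE.
  rewrite -IHm ?(ltnW lt_mk) // -(stab (Ordinal lt_mk) (y m) w).
  congr (_ \in A); apply/ffunP => j; rewrite mixE !ffunE ltnS leq_eqVlt -val_eqE /=.
  by case: eqP.
rewrite -(y_A k) //; congr (_ \in A); apply/ffunP => j.
by rewrite ffunE ltn_ord.
Qed.

(** A 0-1 valued sum of functions of one coordinate each depends on at most one coordinate, since
    two varying summands would produce three values. *)
Lemma exchange_invariant_slice (A : {set E}) : (0 < k)%N -> exchange_invariant A ->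
  exists h (J : {set 'I_(n h)}), A = [set z : E | z h \in J].
Proof.
move=> k0 exA.
have [[h [z [w zw]]]|stab] :=
  pselect (exists h, exists z, exists w, (mix h w z \in A) <> (z \in A)).
  (* Replacing coordinate [h] by that of [w] changes the indicator at [y] as it does at [z], by 1 or
     -1, which determines its value at [y]. *)
  have fix_h y : y h = z h -> (y \in A) = (z \in A).
    move=> yh; have := exA h y (mix h w z).
    rewrite (_ : mix h y (mix h w z) = z); last first.
      by apply/ffunP => j; rewrite !mixE; case: eqP => // ->.
    by move: zw; do 4!case: (_ \in A).
  have dep y : (y \in A) = (mix h y z \in A).
    have := exA h z y; rewrite (fix_h (mix h z y)) ?mixE ?eqxx //.
    by do 3!case: (_ \in A).
  exists h, [set y h | y : E in A]; apply/setP => y; rewrite inE.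
  apply/idP/imsetP => [yA|[y' y'A e]]; first by exists y.
  rewrite dep (_ : mix h y z = mix h y' z) -?dep //.
  by apply/ffunP => j; rewrite !mixE; case: eqP => // ->.
have cst z w : (w \in A) = (z \in A).
  apply: stable_coordinates => h y u; apply: contrapT => ne.
  by apply: stab; exists h, y, u.
(* No coordinate matters, so [A] is empty or full and is a slice in any direction. *)
exists (Ordinal k0); have [->|/set0Pn[z zA]] := eqVneq A set0.
  by exists set0; apply/setP => z; rewrite !inE.
by exists setT; apply/setP => w; rewrite !inE (cst z).
Qed.

End Grid.

Section GridWeight.
Variables (k : nat) (n : 'I_k -> nat) (C : finType) (c0 : C).
Local Notation E := {dffun forall h : 'I_k, 'I_(n h)}.

Definition slice h (J : {set 'I_(n h)}) : {set E * C} := [set i : E * C | i.1 h \in J].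

Lemma grid_weight : (0 < k)%N -> (1 < #|C|)%N ->
  exists b : E * C -> nat, [/\ forall i, (0 < b i)%N,
    forall c z w, b (z, c) = b (w, c) -> z = w &
    forall A : {set E * C},
      (forall c, \sum_(i in A | i.2 == c) b i = \sum_(i in A | i.2 == c0) b i)%N <->
      exists h (J : {set 'I_(n h)}), A = slice J].
Proof.
move=> k0 C1.
pose delta (t : E * E * 'I_k) (y : E) : int :=
  let: (z, w, h) := t in
  (y == z)%:Z + (y == w)%:Z - ((y == mix h w z)%:Z + (y == mix h z w)%:Z).
(* Paired with the difference of the indicators of A over c0 and over c, the
   functional [inl z] tests whether the two sections of A agree at z, and
   [inr t] the exchange relation t on the section over c0. *)
pose d (t : E + E * E * 'I_k) (i : E * C) : int :=
  match t with
  | inl z => (i.1 == z)%:Z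
  | inr t => if i.2 == c0 then delta t i.1 else 0
  end.
have [b [b0 bP]] := separating_weight d; exists b.
have section_sum (R : nmodType) (A : {set E * C}) c (g : E * C -> R) :
    \sum_(i in A | i.2 == c) g i = \sum_(z | (z, c) \in A) g (z, c).
  rewrite (reindex_onto (fun z => (z, c)) fst) /=; last first.
    by case=> z c' /andP[_ /= /eqP->].
  by apply: eq_bigl => z; rewrite /= !eqxx !andbT.
have indicator_sum (P : pred E) z : \sum_(y | P y) (y == z)%:Z = (P z)%:Z.
  rewrite big_mkcond (bigD1 z) //= eqxx big1 ?addr0; first by case: (P z).
  by move=> y /negPf->; case: (P y).
have delta_sum (A : {set E * C}) c z w h :
    \sum_(y | (y, c) \in A) delta (z, w, h) y =
    ((z, c) \in A)%:Z + ((w, c) \in A)%:Z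
      - (((mix h w z, c) \in A)%:Z + ((mix h z w, c) \in A)%:Z).
  by rewrite /delta sumrB !big_split /= !indicator_sum.
split=> // [c z w ezw|A].
  (* If [b] agrees at the two points, their difference pairs to 0 with [b], hence with the
     functional [inl z], which forces [w = z]. *)
  pose x i : int := (i == (z, c))%:Z - (i == (w, c))%:Z.
  have x1 i : `|x i| <= 1 by rewrite /x; do 2!case: eqP.
  have xP (g : E * C -> int) : \sum_i x i * g i = g (z, c) - g (w, c).
    rewrite /x; under eq_bigr => i _ do rewrite mulrBl.
    rewrite sumrB; congr (_ - _).
      rewrite (bigD1 (z, c)) //= eqxx mul1r big1 ?addr0 // => i /negPf->.
      by rewrite mul0r.
    rewrite (bigD1 (w, c)) //= eqxx mul1r big1 ?addr0 // => i /negPf->.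
    by rewrite mul0r.
  have [+ _] := bP x x1; rewrite xP ezw subrr => /(_ erefl)[_ /(_ (inl z))].
  by rewrite xP /= eqxx; case: eqP.
pose x c i : int := (i \in A)%:Z * ((i.2 == c0)%:Z - (i.2 == c)%:Z).
have x1 c i : `|x c i| <= 1 by rewrite /x; do 3!case: (_ \in _) || case: eqP.
have xP c (g : E * C -> int) : \sum_i x c i * g i =
    \sum_(z | (z, c0) \in A) g (z, c0) - \sum_(z | (z, c) \in A) g (z, c).
  rewrite -!section_sum /x; under eq_bigr => i _ do rewrite mulrBr mulrBl.
  rewrite sumrB; congr (_ - _); rewrite [RHS]big_mkcond /=; apply: eq_bigr => i _.
    by case: (i \in A); case: eqP; rewrite ?mul1r ?mul0r.
  by case: (i \in A); case: eqP; rewrite ?mul1r ?mul0r.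
have sumE c : (\sum_(i in A | i.2 == c) b i)%:Z = \sum_(z | (z, c) \in A) (b (z, c))%:Z.
  by rewrite section_sum (big_morph Posz PoszD (erefl _)).
have balP c : (\sum_(i in A | i.2 == c) b i = \sum_(i in A | i.2 == c0) b i)%N <->
    \sum_i x c i = 0 /\ forall t, \sum_i x c i * d t i = 0.
  rewrite -bP // xP -!sumE; split=> [->|]; first by rewrite subrr.
  by move/subr0_eq => [].
split=> [bal|[h [J eA]] c].
  have sec c z : ((z, c) \in A) = ((z, c0) \in A).
    have /balP[_ /(_ (inl z))] := bal c; rewrite xP /= !indicator_sum.
    by do 2!case: (_ \in A).
  (* For [c = c0] the vector [x c] is 0; the exchange relations are read off at a second class. *)
  have [c1 c10] : exists c1, c1 != c0.
    move: C1; rewrite (cardD1 c0) ltnS => /card_gt0P[c1].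
    by rewrite !inE andbT; exists c1.
  pose A0 : {set E} := [set z | (z, c0) \in A].
  have [|h [J eA0]] := @exchange_invariant_slice k n A0 k0.
    move=> h z w; have /balP[_ /(_ (inr (z, w, h)))] := bal c1.
    rewrite xP /= eqxx (negPf c10) delta_sum [X in _ - X]big1 // subr0 !inE.
    by do 4!case: (_ \in A).
  exists h, J; apply/setP => -[z c]; rewrite sec inE /=.
  by have /setP/(_ z) := eA0; rewrite !inE.
have [->//|cc0] := eqVneq c c0.
have inA z c' : ((z, c') \in A) = (z h \in J) by rewrite eA inE.
have same (g : E -> int) :
    \sum_(z | (z, c0) \in A) g z = \sum_(z | (z, c) \in A) g z.
  by apply: eq_bigl => z; rewrite !inA.
apply/balP; split=> [|[z|[[z w] h']]].
- have := xP c (fun=> 1); under eq_bigr => i _ do rewrite mulr1.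
  by move=> ->; rewrite (same (fun=> 1)) subrr.
- by rewrite xP /= (same (fun y => (y == z)%:Z)) subrr.
- rewrite xP /= eqxx (negPf cc0) delta_sum [X in _ - X]big1 // subr0 !inA.
  have := slice_exchange_invariant J h' z w; rewrite !inE => e.
  by rewrite -!PoszD e subrr.
Qed.

End GridWeight.

(** * Factorizations into slices *)

Section SliceFactorizations.
Variables (k : nat) (n : 'I_k -> nat) (C : finType) (c0 : C) (R : idomainType).
Local Notation E := {dffun forall h : 'I_k, 'I_(n h)}.
Local Notation slice := (@slice k n C _).
Hypotheses (k0 : (0 < k)%N) (n1 : forall h, (1 < n h)%N).
Variable tight : {set E * C} -> bool.
Variable Bl : {set E * C} -> R.
Hypotheses
  (tightP : forall A, tight A <-> exists h (J : {set 'I_(n h)}), A = slice J)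
  (Bl_factor : forall T u w, tight T -> Bl T = u * w ->
     exists A : {set E * C}, [/\ A \subset T, tight A, tight (T :\: A),
                   associated u (Bl A) & associated w (Bl (T :\: A))])
  (BlD : forall T A, tight T -> tight A -> A \subset T ->
     tight (T :\: A) /\ Bl T = Bl A * Bl (T :\: A))
  (Bl0 : Bl set0 = 1)
  (Bl_unit : forall A, tight A -> Bl A \is a GRing.unit -> A = set0)
  (Bl_neq0 : forall A, tight A -> Bl A != 0)
  (Bl_sub : forall A B, tight A -> tight B -> associated (Bl A) (Bl B) -> A \subset B).

Lemma tight_slice h (J : {set 'I_(n h)}) : tight (slice J).
Proof. by apply/tightP; exists h, J. Qed.

Lemma grid_point h (j : 'I_(n h)) : exists z : E, z h = j.
Proof.
exists [ffun i => dfwith (fun i => Ordinal (ltnW (n1 i))) j i].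
by rewrite ffunE dfwith_in.
Qed.

Lemma mem_slice h (J : {set 'I_(n h)}) i : (i \in slice J) = (i.1 h \in J).
Proof. by rewrite inE. Qed.

Lemma slice_subset h (J J' : {set 'I_(n h)}) :
  slice J' \subset slice J -> J' \subset J.
Proof.
move=> /subsetP s; apply/subsetP => j jJ; have [z zj] := grid_point j.
by have := s (z, c0); rewrite !mem_slice zj; apply.
Qed.

(** In different directions, a point can be chosen with coordinate [h'] in [J'] and coordinate [h]
    outside [J]. *)
Lemma slice_subset_dir h h' (J : {set 'I_(n h)}) (J' : {set 'I_(n h')}) :
  J' != set0 -> J != setT -> slice J' \subset slice J -> h' = h.
Proof.
move=> /set0Pn[j' j'J] JT /subsetP s; apply/eqP; apply: contraTT isT => hh'.
have [j _ jJ] : exists2 j, j \in setT & j \notin J.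
  by apply/subsetPn; rewrite subTset.
have [z zj] := grid_point j; have [z' zj'] := grid_point j'.
have := s (mix h' z' z, c0); rewrite !mem_slice !mixE eqxx zj'.
by rewrite eq_sym (negPf hh') zj (negPf jJ) => /(_ j'J).
Qed.

Lemma slice0 h : slice (set0 : {set 'I_(n h)}) = set0.
Proof. by apply/setP => i; rewrite mem_slice !inE. Qed.

Lemma sliceT h : slice [set: 'I_(n h)] = setT.
Proof. by apply/setP => i; rewrite mem_slice !inE. Qed.

Lemma sliceD h (J J' : {set 'I_(n h)}) : slice (J :\: J') = slice J :\: slice J'.
Proof. by apply/setP => i; rewrite !(mem_slice, inE). Qed.

Lemma slice_eq0 h (J : {set 'I_(n h)}) : slice J = set0 -> J = set0.
Proof.
by move=> e; apply/eqP; rewrite -subset0; apply: slice_subset; rewrite e sub0set.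
Qed.

Lemma set1_neqT h (j : 'I_(n h)) : [set j] != setT.
Proof.
apply: contraTneq (n1 h) => e.
by rewrite -leqNgt -(card_ord (n h)) -cardsT -e cards1.
Qed.

Lemma slice1_nunit h (j : 'I_(n h)) : Bl (slice [set j]) \isn't a GRing.unit.
Proof.
apply/negP => /(Bl_unit (tight_slice _))/slice_eq0/setP/(_ j).
by rewrite !inE eqxx.
Qed.

Lemma associated_Bl0 (r : R) : associated r (Bl set0) -> r \is a GRing.unit.
Proof. by move/associated_unit ->; rewrite Bl0 unitr1. Qed.

(** A factor comes from a slice inside a single one. If nonempty, it has the same direction and is
    all of it, so the cofactor is a unit. *)
Lemma slice1_irreducible h (j : 'I_(n h)) : irreducible_elt (Bl (slice [set j])).
Proof.
split=> [||b c e]; [exact/Bl_neq0/tight_slice | exact: slice1_nunit |].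
have [A [sA /tightP[h' [J' eA]] _ bA cA]] := Bl_factor (tight_slice _) e.
have [J0|J'0] := eqVneq J' set0.
  by left; apply: associated_Bl0; rewrite -(slice0 h') -J0 -eA.
rewrite {}eA in sA bA cA.
have hh := slice_subset_dir J'0 (set1_neqT j) sA; subst h'.
have := slice_subset sA; rewrite subset1 (negPf J'0) orbF => /eqP eJ'.
by right; apply: associated_Bl0; rewrite -(setDv (slice [set j])) -{2}eJ'.
Qed.

(** The factor [x] comes from a nonempty slice, from which a single [j] splits off; by
    irreducibility nothing else remains. *)
Lemma first_factor T x w : tight T -> associated (Bl T) (x * w) ->
  irreducible_elt x ->
  exists h (j : 'I_(n h)), [/\ slice [set j] \subset T,
    associated (Bl (slice [set j])) x & associated (Bl (T :\: slice [set j])) w].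
Proof.
move=> tT [e ue]; rewrite mulrCA => eT irr_x.
have [A [sA tA _ xA wA]] := Bl_factor tT eT.
have [h [J eJ]] := (tightP A).1 tA; have irrA := irreducible_associated xA irr_x.
have [J0|/set0Pn[j jJ]] := eqVneq J set0.
  by case: irrA => _ /negP[]; rewrite eJ J0 slice0 Bl0 unitr1.
have sj : slice [set j] \subset A.
  by rewrite eJ; apply/subsetP => i; rewrite !mem_slice inE => /eqP->.
have [tD eD] := BlD tA (tight_slice [set j]) sj.
have Aj : A = slice [set j].
  case: irrA => _ _ /(_ _ _ eD)[]; first by rewrite (negPf (slice1_nunit j)).
  move/(Bl_unit tD)/eqP; rewrite setD_eq0 => s.
  by apply/eqP; rewrite eqEsubset s sj.
rewrite {}Aj in sA xA wA; exists h, j; split => //; first exact: associated_sym.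
by apply/associated_sym/(associated_trans _ wA); exists e^-1; rewrite ?unitrV ?mulKr.
Qed.

(** Properness of [J] forces every factor into the direction [h], and persists when an index is
    removed. The full grid, a slice in every direction, is excluded. *)
Lemma slice_factors h (u : seq R) (J : {set 'I_(n h)}) :
  (forall a, a \in u -> irreducible_elt a) -> J != setT ->
  associated (Bl (slice J)) (\prod_(a <- u) a) ->
  exists js : seq 'I_(n h), [/\ uniq js, js =i J, size js = size u &
    forall j0 i, (i < size u)%N -> associated (Bl (slice [set nth j0 js i])) u`_i].
Proof.
elim: u J => [|x u IHu] J irr_u JT.
  rewrite big_nil -Bl0 => /associated_Bl0/(Bl_unit (tight_slice J))/slice_eq0 ->.
  by exists [::]; split=> // j; rewrite inE.
rewrite big_cons => /(first_factor (tight_slice J))[|h' [j [sj xj wj]]].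
  by apply: irr_u; rewrite mem_head.
have j0 : [set j] != set0 by apply/set0Pn; exists j; rewrite set11.
have hh := slice_subset_dir j0 JT sj; subst h'.
have jJ : j \in J by rewrite -sub1set; exact: slice_subset.
rewrite -sliceD in wj.
have [||js [us mem_js sz_js jsP]] := IHu (J :\ j) _ _ wj.
- by move=> a au; apply: irr_u; rewrite inE au orbT.
- by apply: contraNneq JT => e; rewrite -subTset -e subsetDl.
exists (j :: js); split=> [|i||i0 [|i]] //=.
- by rewrite us mem_js !inE eqxx.
- by rewrite inE mem_js !inE; case: eqVneq => // ->.
- by rewrite sz_js.
- exact: jsP.
Qed.

Lemma prod_slice1 h (js : seq 'I_(n h)) : uniq js ->
  \prod_(j <- js) Bl (slice [set j]) = Bl (slice [set j in js]).
Proof.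
elim: js => [_|j js IHjs /= /andP[j_js /IHjs e]].
  by rewrite big_nil set_nil slice0 Bl0.
rewrite big_cons e set_cons.
have sj : slice [set j] \subset slice (j |: [set i in js]).
  by apply/subsetP => i; rewrite !mem_slice !inE => ->.
have [_ ->] := BlD (tight_slice _) (tight_slice [set j]) sj.
congr (_ * Bl _); rewrite -sliceD; congr slice; apply/setP => i.
by rewrite !inE; case: eqVneq => // ->; rewrite (negPf j_js).
Qed.

Lemma slice_factorizations : exists (H : R) (fac : 'I_k -> seq R),
  [/\ forall i, factorization H (fac i),
      forall i, size (fac i) = n i,
      forall i j, i != j -> ~ essentially_same (fac i) (fac j) &
      forall u, factorization H u -> exists i, essentially_same u (fac i)].
Proof.
pose fac h := [seq Bl (slice [set j]) | j <- enum 'I_(n h)].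
have sz h : size (fac h) = n h by rewrite size_map size_enum_ord.
have tT : tight setT by rewrite -(sliceT (Ordinal k0)) tight_slice.
exists (Bl setT), fac; split=> // [h|h h' hh' [_ [t pt ass]]|u [eu irr_u]].
- split; last by move=> _ /mapP[j _ ->]; exact: slice1_irreducible.
  rewrite big_map prod_slice1 ?enum_uniq // -(sliceT h); congr (Bl (slice _)).
  by apply/setP => j; rewrite !inE mem_enum.
(* Associated factors would give nested single slices, hence equal directions. *)
- have h0 : (0 < size (fac h))%N by rewrite sz ltnW.
  have /mapP[j _ ej] := mem_nth 0 h0.
  have : t`_0 \in fac h'.
    by rewrite -(perm_mem pt) mem_nth // (perm_size pt) sz ltnW.
  move=> /mapP[j' _ ej']; have := ass 0 h0; rewrite ej ej'.
  move/(Bl_sub (tight_slice _) (tight_slice _))/slice_subset_dir => e.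
  case/eqP: hh'; apply/esym/e; last exact: set1_neqT.
  by apply/set0Pn; exists j'; rewrite set11.
case: u => [|x u] in eu irr_u *.
  have : Bl setT \is a GRing.unit by rewrite eu big_nil unitr1.
  have [z _] := grid_point (Ordinal (ltnW (n1 (Ordinal k0)))).
  by move/(Bl_unit tT)/setP/(_ (z, c0)); rewrite !inE.
(* The first factor selects the direction [h]; its complement is a proper slice, so the other
   factors follow that direction. *)
have [|h [j [sj xj wj]]] :=
  @first_factor setT x (\prod_(a <- u) a) tT _ (irr_u _ (mem_head _ _)).
  by rewrite eu big_cons; exact: associated_refl.
rewrite -(sliceT h) -sliceD in wj.
have [||js [us mem_js sz_js jsP]] := slice_factors _ _ wj.
- by move=> a au; apply: irr_u; rewrite inE au orbT.
- by apply/eqP => /setP/(_ j); rewrite !inE eqxx.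
have perm_js : perm_eq (j :: js) (enum 'I_(n h)).
  apply: uniq_perm; rewrite ?enum_uniq //= ?us ?mem_js ?inE ?eqxx // => i.
  by rewrite mem_enum !inE mem_js !inE; case: eqVneq.
have pm : perm_eq [seq Bl (slice [set j]) | j <- j :: js] (fac h) by exact: perm_map.
exists h; split; first by rewrite -(perm_size pm) /= size_map sz_js.
exists [seq Bl (slice [set j]) | j <- j :: js] => // -[|i] //= lt_i.
by rewrite (nth_map j) ?sz_js //; exact: jsP.
Qed.

End SliceFactorizations.

Theorem theorem1 (D : idomainType) (hD : krull_domain D)
    (p : D) (hp : prime_elt p) (hfin : finite_set (cosets p)) :
  full_system_of_multisets_of_lengths (Int D).
Proof.
move=> k n k0 n1 _.
have [v [hv vp v_ndvd]] := krull_valuation hp hD.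
have [C [L [cl [C1 sL LP clS L0]]]] := residue_system hp hfin.
have [b [b0 b_inj bP]] := grid_weight n (cl 0) k0 C1.
pose F := grid_poly p L b; pose wt := grid_val b.
have Firr := grid_poly_irreducible hp hv vp sL b0.
have Fval := grid_poly_val hp LP b0.
have Fval0 := grid_poly_val0 hp b LP L0.
have totalE c A : total wt c A = (\sum_(i in A | i.2 == c) b i)%N.
  by rewrite /total /wt /grid_val -big_mkcondr.
apply: (@slice_factorizations k n C (cl 0) (Int D) k0 n1
          (tight cl wt) (block p cl F wt)).
(* For the grid polynomials, [total] is the sum of [b] over one class, so tightness is the balance
   condition of [grid_weight]. *)
- move=> A; rewrite -bP; split=> [/tightP tA c|tA]; first by rewrite -!totalE.
  by apply/tightP => c; rewrite !totalE.
- exact: (block_factor hp hv vp v_ndvd clS Firr Fval Fval0).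
- exact: (blockD hp Fval).
- exact: (block0 hp Fval).
- exact: (block_unit hp Firr Fval).
- exact: (block_neq0 hp Fval Fval0).
- move=> A B; apply: (associated_block_sub hp Firr Fval).
  exact: (grid_poly_inj hp hv vp v_ndvd C1 LP clS b0 b_inj).
Qed.
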